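(* Suppose $f\in\mathrm{Homeo}_0(\mathbb{T}^2)$ is a non-wandering irrational pseudo-rotation with unbounded mean motion (i.e. $f$ does not have bounded mean motion). Then $f$ has sensitive dependence on initial conditions.
   Context: $\mathbb{T}^2=\mathbb{R}^2/\mathbb{Z}^2$ with quotient map $\pi$ and the usual Euclidean distance $d$. $\mathrm{Homeo}_0(\mathbb{T}^2)$ is the set of homeomorphisms of $\mathbb{T}^2$ homotopic to the identity; a lift of $f$ is a continuous $F:\mathbb{R}^2\to\mathbb{R}^2$ with $\pi\circ F=f\circ\pi$. The rotation set is $\rho(F)=\{\rho\in\mathbb{R}^2\mid\exists\, n_i\nearrow\infty,\ z_i\in\mathbb{R}^2:\ \lim_{i\to\infty}(F^{n_i}(z_i)-z_i)/n_i=\rho\}$. $(\rho_1,\rho_2)$ is totally irrational if $1,\rho_1,\rho_2$ are linearly independent over $\mathbb{Q}$. $f$ is an irrational pseudo-rotation if $\rho(F)=\{\rho\}$ with $\rho$ totally irrational; it then has bounded mean motion if the vectors $D(n,z)=F^n(z)-z-n\rho$ are bounded uniformly in $n$ and $z$. $f$ is non-wandering if there is no non-empty open set $U\subseteq\mathbb{T}^2$ with $U\cap f^n(U)=\emptyset$ for all $n\in\mathbb{N}=\{1,2,\ldots\}$. A continuous map $f:X\to X$ of a metric space has sensitive dependence on initial conditions if there is $\varepsilon>0$ such that for all $z\in X$ and $\delta>0$ there exist $z'\in X$ with $d(z,z')<\delta$ and an integer $n\geq 0$ with $d(f^n(z),f^n(z'))\geq\varepsilon$. *)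

(* Defs.v *)
From HB Require Import structures.
From mathcomp Require Import all_boot all_order all_algebra generic_quotient.
From mathcomp Require Import all_classical all_reals all_analysis.

Set Implicit Arguments.
Unset Strict Implicit.
Unset Printing Implicit Defensive.

Import Order.TTheory GRing.Theory Num.Theory.
Import numFieldNormedType.Exports.

Local Open Scope classical_set_scope.
Local Open Scope ring_scope.
Local Open Scope quotient_scope.

Section Torus.
Variable R : realType.

Definition lattice_rel (x y : R * R) : bool :=
  (x.1 - y.1 \is a Num.int) && (x.2 - y.2 \is a Num.int).

Lemma lattice_rel_refl : reflexive lattice_rel.
Proof. by move=> x; rewrite /lattice_rel !subrr !rpred0. Qed.

Lemma lattice_rel_sym : symmetric lattice_rel.
Proof. by move=> x y; rewrite /lattice_rel -!(rpredBC _ x.1, rpredBC _ x.2). Qed.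

Lemma lattice_rel_trans : transitive lattice_rel.
Proof.
move=> y x z /andP[xy1 xy2] /andP[yz1 yz2]; apply/andP; split.
- by rewrite -(subrKA y.1); exact: rpredD.
- by rewrite -(subrKA y.2); exact: rpredD.
Qed.

Canonical lattice_equiv :=
  EquivRel lattice_rel lattice_rel_refl lattice_rel_sym lattice_rel_trans.

Definition torus := quotient_topology {eq_quot lattice_equiv}.
HB.instance Definition _ := Topological.on torus.

Definition torus_pi (x : R * R) : torus := \pi_({eq_quot lattice_equiv}) x.

(* The norm that the library puts on R * R is the sup norm. *)
Definition euclidean_dist (x y : R * R) : R :=
  Num.sqrt ((x.1 - y.1) ^+ 2 + (x.2 - y.2) ^+ 2).

Definition torus_dist (p q : torus) : R :=
  inf [set r | exists x y,
    [/\ torus_pi x = p, torus_pi y = q & r = euclidean_dist x y]].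

Definition homeomorphism (X Y : topologicalType) (f : X -> Y) : Prop :=
  continuous f /\ exists g : Y -> X, [/\ continuous g, cancel f g & cancel g f].

Definition homotopic (X Y : topologicalType) (f g : X -> Y) : Prop :=
  exists H : R * X -> Y,
    [/\ {within `[0, 1] `*` setT, continuous H},
        forall x, H (0, x) = f x
      & forall x, H (1, x) = g x].

Definition Homeo0 : set (torus -> torus) :=
  [set f | homeomorphism f /\ homotopic f id].

Definition is_lift (f : torus -> torus) (F : R * R -> R * R) : Prop :=
  continuous F /\ torus_pi \o F = f \o torus_pi.

Definition rotation_set (F : R * R -> R * R) : set (R * R) :=
  [set rho : R * R | exists (n : nat -> nat) (z : nat -> R * R),
    {homo n : i j / (i < j)%N} /\
    (fun i => (n i)%:R^-1 *: (iter (n i) F (z i) - z i)) @ \oo --> rho].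

Definition totally_irrational (rho : R * R) : Prop :=
  forall a b c : rat, ratr a + ratr b * rho.1 + ratr c * rho.2 = 0 ->
    [/\ a = 0, b = 0 & c = 0].

(* Replacing the lift F by F + v with v in Z^2 replaces rho by rho + v and
   leaves the displacements F^n(z) - z - n rho unchanged, so that the next two
   notions do not depend on the lift chosen for f. *)
Definition irrational_pseudo_rotation (f : torus -> torus)
    (F : R * R -> R * R) (rho : R * R) : Prop :=
  [/\ is_lift f F, rotation_set F = [set rho] & totally_irrational rho].

Definition bounded_mean_motion (F : R * R -> R * R) (rho : R * R) : Prop :=
  exists M : R, forall (n : nat) (z : R * R),
    euclidean_dist (iter n F z - z - n%:R *: rho) 0 <= M.

Definition nonwandering (X : topologicalType) (f : X -> X) : Prop :=
  ~ exists U : set X, [/\ open U, U !=set0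
    & forall n, (0 < n)%N -> U `&` (iter n f @` U) = set0].

Definition sensitive_dependence (X : Type) (d : X -> X -> R) (f : X -> X) :
    Prop :=
  exists2 e : R, 0 < e & forall (z : X) (delta : R), 0 < delta ->
    exists z' : X, d z z' < delta /\
      exists n : nat, e <= d (iter n f z) (iter n f z').

End Torus.

(* Main.v *)
Require Import Defs.
From mathcomp Require Import all_boot all_order all_algebra generic_quotient.
From mathcomp Require Import all_classical all_reals all_analysis.
From mathcomp Require Import ring lra zify.

Set Implicit Arguments.
Unset Strict Implicit.
Unset Printing Implicit Defensive.

Import Order.TTheory GRing.Theory Num.Theory.
Import numFieldNormedType.Exports.

Local Open Scope classical_set_scope.
Local Open Scope ring_scope.
Local Open Scope quotient_scope.

(* If sensitivity fails, some ball B around z has all its forward images under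
   the lift F of diameter at most 1. Call p and q linked if, at every scale, a
   chain of small steps joins them whose points follow each other within a
   constant distance under all iterates; this is an equivalence relation
   invariant under F and under Z^2, and B lies in one class. A return of B to
   itself gives F^n z ~ z + v, so two returns give z ~ z + (m v - n w).
   Non-wandering yields arbitrarily long returns, for which v / n tends to rho,
   and total irrationality then provides two independent periods u with
   z ~ z + u.

   For each such u, the u-periodic chain through z is a barrier whose images
   under F^n stay in strips of constant width along u. Since F^n is injective,
   a point on one side of the barrier cannot be mapped far to the other side:
   the image of a ray leaving the point away from the barrier would otherwise
   meet the image of the barrier, by a discrete Poincare-Miranda argument. Hence
   the displacements of all points agree up to a constant, transversally to both
   periods, and averaging gives bounded mean motion.

   That F commutes with Z^2 is deduced from the uniqueness of the rotation
   vector. *)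

(** * A discrete Poincare-Miranda theorem *)

(** [e] marks the edges with both ends in [Q] and different values of [P]. Around a cell that is not
    mixed for both, the number of marked edges is even; adding over the row, the inner vertical
    edges cancel modulo 2. *)
Lemma xor_telescope (N j : nat) (P Q : nat -> nat -> bool) :
  (forall i, (i < N)%N ->
    ~~ [&& [|| P i j, P i.+1 j, P i j.+1 | P i.+1 j.+1],
           ~~ [&& P i j, P i.+1 j, P i j.+1 & P i.+1 j.+1],
           [|| Q i j, Q i.+1 j, Q i j.+1 | Q i.+1 j.+1] &
           ~~ [&& Q i j, Q i.+1 j, Q i j.+1 & Q i.+1 j.+1]]) ->
  let e i j i' j' := [&& Q i j, Q i' j' & P i j (+) P i' j'] in
  \big[addb/false]_(0 <= i < N) e i j i.+1 j (+)
  \big[addb/false]_(0 <= i < N) e i j.+1 i.+1 j.+1 =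
  e 0%N j 0%N j.+1 (+) e N j N j.+1.
Proof.
move=> H e; elim: N H => [|N IH] H; first by rewrite !big_geq// !addbb.
rewrite !big_nat_recr//=.
have {IH}/= := IH (fun i iN => H i (ltnW iN)).
set a := \big[addb/false]_(_ <= _ < _) _.
set b := \big[addb/false]_(_ <= _ < _) _.
have := H N (ltnSn N); rewrite /e.
case: (P N j); case: (P N.+1 j); case: (P N j.+1); case: (P N.+1 j.+1);
case: (Q N j); case: (Q N.+1 j); case: (Q N j.+1); case: (Q N.+1 j.+1) => //= _;
case: a; case: b; case: [&& _, _ & _] => //.
Qed.

(* Sperner's parity argument: the horizontal edges of a row whose two ends
   satisfy Q and differ on P have the same parity in all rows if no cell is
   mixed for both P and Q, but the bottom row has an odd number of them and the
   top row has none. *)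
Lemma mixed_cell (N M : nat) (P Q : nat -> nat -> bool) :
  (forall j, P 0%N j) -> (forall j, ~~ P N j) ->
  (forall i, Q i 0%N) -> (forall i, ~~ Q i M) ->
  exists i j, [&& (i < N)%N, (j < M)%N,
    [|| P i j, P i.+1 j, P i j.+1 | P i.+1 j.+1],
    ~~ [&& P i j, P i.+1 j, P i j.+1 & P i.+1 j.+1],
    [|| Q i j, Q i.+1 j, Q i j.+1 | Q i.+1 j.+1] &
    ~~ [&& Q i j, Q i.+1 j, Q i j.+1 & Q i.+1 j.+1]].
Proof.
move=> P0 PN Q0 QM; apply: contrapT => none.
pose e i j i' j' := [&& Q i j, Q i' j' & P i j (+) P i' j'].
pose r j := \big[addb/false]_(0 <= i < N) e i j i.+1 j.
have rS j : (j < M)%N -> r j.+1 = r j.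
  move=> jM; have T := @xor_telescope N j P Q.
  have {T} : r j (+) r j.+1 = e 0%N j 0%N j.+1 (+) e N j N j.+1.
    apply: T => i iN; apply/negP => bad.
    by apply: none; exists i, j; rewrite iN jM.
  rewrite /e !P0 !(negbTE (PN _)) /= !andbF /=.
  by case: (r j); case: (r j.+1).
have rM : r M = r 0%N.
  suff H j : (j <= M)%N -> r j = r 0%N by exact: H.
  by elim: j => // j IH jM; rewrite rS// IH// ltnW.
have r0 n : \big[addb/false]_(0 <= i < n) e i 0%N i.+1 0%N =
    P 0%N 0%N (+) P n 0%N.
  elim: n => [|n IH]; first by rewrite big_geq// addbb.
  rewrite big_nat_recr//= IH /e !Q0 /=.
  by case: (P 0%N 0%N); case: (P n 0%N); case: (P n.+1 0%N).
move: rM; rewrite /r r0 P0 (negbTE (PN _)).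
by rewrite big1// => i _; rewrite /e (negbTE (QM i)).
Qed.

(** In a cell mixed for both signs each function takes both signs, and any two corners are at most
    two edges apart. *)
Lemma approximate_zero (R : realDomainType) (N M : nat) (a b : nat -> nat -> R)
    (k : R) :
  (forall j, a 0%N j < 0) -> (forall j, 0 <= a N j) ->
  (forall i, b i 0%N < 0) -> (forall i, 0 <= b i M) ->
  (forall i j, `|a i.+1 j - a i j| <= k) ->
  (forall i j, `|a i j.+1 - a i j| <= k) ->
  (forall i j, `|b i.+1 j - b i j| <= k) ->
  (forall i j, `|b i j.+1 - b i j| <= k) ->
  exists i j, [/\ (i <= N)%N, (j <= M)%N,
    `|a i j| <= 2 * k & `|b i j| <= 2 * k].
Proof.
move=> a0 aN b0 bM a1 a2 b1 b2.
have [||i [j /and5P[iN jM Pt Pf /andP[Qt Qf]]]] :=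
  @mixed_cell N M (fun i j => a i j < 0) (fun i j => b i j < 0) a0 _ b0 _.
- by move=> j; rewrite -leNgt.
- by move=> i; rewrite -leNgt.
have small (g : nat -> nat -> R) : (forall i j, `|g i.+1 j - g i j| <= k) ->
    (forall i j, `|g i j.+1 - g i j| <= k) ->
    [|| g i j < 0, g i.+1 j < 0, g i j.+1 < 0 | g i.+1 j.+1 < 0] ->
    ~~ [&& g i j < 0, g i.+1 j < 0, g i j.+1 < 0 & g i.+1 j.+1 < 0] ->
    `|g i j| <= 2 * k.
  move=> g1 g2; move: (g1 i j) (g2 i j) (g1 i j.+1) (g2 i.+1 j).
  rewrite !ler_norml !negb_and -!leNgt => /andP[? ?] /andP[? ?] /andP[? ?] /andP[? ?].
  by move=> /or4P[] ? /or4P[] ?; apply/andP; split; lra.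
by exists i, j; split; [exact: ltnW|exact: ltnW|exact: small|exact: small].
Qed.

(** * Sup norm, sequential compactness and intermediate values *)

Lemma norm_pair_le (R : realType) (x : R * R) (e : R) :
  (`|x| <= e) = (`|x.1| <= e) && (`|x.2| <= e).
Proof. by rewrite prod_normE ge_max. Qed.

Lemma norm_pair_lt (R : realType) (x : R * R) (e : R) :
  (`|x| < e) = (`|x.1| < e) && (`|x.2| < e).
Proof. by rewrite prod_normE gt_max. Qed.

Lemma cvgn_distP (R : realType) (V : normedModType R) (u : nat -> V) (l : V) :
  u @ \oo --> l <->
  forall e, 0 < e -> exists N, forall n, (N <= n)%N -> `|l - u n| < e.
Proof.
split=> [ul e e0|H].
  move/cvgrPdist_lt: ul => /(_ e e0)[N _ HN].
  by exists N => n Nn; apply: HN.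
apply/cvgrPdist_lt => e /H[N HN]; exists N => // n /= Nn; exact: HN.
Qed.

Lemma leq_homo_ltn (s : nat -> nat) :
  {homo s : i j / (i < j)%N} -> forall n, (n <= s n)%N.
Proof. by move=> si; elim=> // n IH; exact: leq_ltn_trans IH (si _ _ _). Qed.

Lemma bolzano_weierstrass_pair (R : realType) (u : nat -> R * R) (c : R) :
  (forall n, `|u n| <= c) ->
  exists2 s : nat -> nat, {homo s : i j / (i < j)%N} &
    exists l : R * R, u \o s @ \oo --> l.
Proof.
move=> uc.
have bnd (v : nat -> R) : (forall n, `|v n| <= c) -> bounded_fun v.
  move=> vc; exists c; split; first exact: num_real.
  by move=> x cx n _; apply: le_trans (vc n) (ltW cx).
have [|s1 s1i cs1] := @bolzano_weierstrass R (fst \o u).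
  by apply: bnd => n; have := uc n; rewrite norm_pair_le => /andP[].
have [|s2 s2i cs2] := @bolzano_weierstrass R (snd \o u \o s1).
  by apply: bnd => n; have := uc (s1 n); rewrite norm_pair_le => /andP[].
have inc (s : nat -> nat) : increasing_seq s -> {homo s : i j / (i < j)%N}.
  by move=> si i j; rewrite !ltnNge; apply: contra; rewrite -(si j i).
exists (s1 \o s2).
  by move=> i j ij; apply: (inc s1 s1i); apply: (inc s2 s2i).
exists (limn (fst \o u \o s1), limn (snd \o u \o s1 \o s2)).
apply/cvgn_distP => e e0.
have /cvgn_distP/(_ e e0)[N1 H1] := cs1.
have /cvgn_distP/(_ e e0)[N2 H2] := cs2.
exists (maxn N1 N2) => n; rewrite geq_max => /andP[n1 n2].
rewrite norm_pair_lt; apply/andP; split; last exact: H2.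
by apply: H1; apply: leq_trans n1 (leq_homo_ltn (inc s2 s2i) n).
Qed.

Lemma ivt_real (R : realType) (g : R -> R) (c : R) :
  continuous g -> g 0 <= c -> c <= g 1 -> exists2 t, 0 <= t <= 1 & g t = c.
Proof.
move=> gc g0 g1.
have [||t] := @IVT R g 0 1 c ler01.
- exact: continuous_subspaceT.
- by rewrite ge_min le_max g0 g1 orbT.
by rewrite in_itv/= => t01 <-; exists t.
Qed.

Lemma segment_continuous (R : realType) (p q : R * R) :
  continuous (fun t : R => p + t *: q).
Proof.
by move=> t; apply: cvgD; [exact: cvg_cst | apply: cvgZr_tmp; exact: cvg_id].
Qed.

Lemma ivt_segment (R : realType) (g : R * R -> R) (p q : R * R) (c : R) :
  continuous g -> g p <= c -> c <= g (p + q) ->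
  exists2 t, 0 <= t <= 1 & g (p + t *: q) = c.
Proof.
move=> gc gp gq.
apply: (@ivt_real R (fun t => g (p + t *: q)) c).
- by move=> t; apply: continuous_comp; [exact: segment_continuous|exact: gc].
- by rewrite scale0r addr0.
- by rewrite scale1r.
Qed.

Lemma int_half_absurd (R : realType) (x y : R) :
  x \is a Num.int -> y \is a Num.int -> y = x + 2^-1 -> False.
Proof.
move=> xi yi yx; have : y - x \is a Num.int by rewrite rpredB.
rewrite yx addrAC subrr add0r => /intrP[m mE].
have : (2 * m = 1 :> int)%R.
  by apply: (@intr_inj R); rewrite intrM -mE mulfV// pnatr_eq0.
by lia.
Qed.

(** Two distinct values would force the smaller one plus 1/2 to be taken on the segment. *)
Lemma int_valued_constant (R : realType) (g : R * R -> R) (p q : R * R) :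
  continuous g -> (forall x, g x \is a Num.int) -> g p = g q.
Proof.
wlog: p q / g p <= g q => [H gc gi|pq gc gi].
  have [pq|/ltW qp] := leP (g p) (g q); first exact: H.
  by apply/esym; exact: H.
apply/eqP; rewrite eq_le pq /= leNgt; apply/negP => pq'.
have [||t _] := @ivt_segment R g p (q - p) (g p + 2^-1) gc.
- by rewrite lerDl invr_ge0 ler0n.
- rewrite [p + _]addrC subrK.
  have /intrP[m mE] := gi p; have /intrP[k kE] := gi q.
  move: pq'; rewrite mE kE ltr_int => mk.
  have : (m + 1 <= k)%R by lia.
  rewrite -(@ler_int R) intrD; lra.
- exact: int_half_absurd (gi _) (gi _).
Qed.

(* Instances of the norm lemmas whose operations on pairs are the ones
   elaborated from user-written terms, so that [lra] identifies the atoms. *)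
Section PairNorm.
Variable R : realType.
Implicit Types x y z : R * R.

Lemma pair_normD x y : `|x + y| <= `|x| + `|y|.
Proof. exact: ler_normD. Qed.

Lemma pair_normB x y : `|x - y| <= `|x| + `|y|.
Proof. exact: ler_normB. Qed.

Lemma pair_distC x y : `|x - y| = `|y - x|.
Proof. exact: distrC. Qed.

Lemma pair_dist_triangle x y z : `|x - z| <= `|x - y| + `|y - z|.
Proof. by rewrite -(subrKA y); exact: ler_normD. Qed.

Lemma pair_normZ (t : R) x : `|t *: x| = `|t| * `|x|.
Proof. exact: normrZ. Qed.

End PairNorm.

(** * The integer lattice and the maps commuting with it *)

Section Lattice.
Variable R : realType.
Implicit Types (x y v w : R * R) (h : R * R -> R * R).

Definition lattice v := (v.1 \is a Num.int) && (v.2 \is a Num.int).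

Lemma latticeB v w : lattice v -> lattice w -> lattice (v - w).
Proof. by move=> /andP[? ?] /andP[? ?]; apply/andP; split; exact: rpredB. Qed.

Lemma lattice0 : lattice 0.
Proof. by apply/andP; split; exact: rpred0. Qed.

Lemma latticeN v : lattice v -> lattice (- v).
Proof. by rewrite -sub0r; apply: latticeB; exact: lattice0. Qed.

Lemma latticeD v w : lattice v -> lattice w -> lattice (v + w).
Proof. by move=> lv lw; rewrite -[w]opprK; apply: latticeB => //; exact: latticeN. Qed.

Lemma latticeMn v n : lattice v -> lattice (v *+ n).
Proof.
move=> lv; elim: n => [|n IH]; first exact: lattice0.
by rewrite mulrS; exact: latticeD.
Qed.

Lemma torus_piP x y : torus_pi x = torus_pi y <-> lattice (x - y).
Proof. by split=> [/eqmodP|?]; last exact/eqmodP. Qed.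

Lemma torus_piD x v : lattice v -> torus_pi (x + v) = torus_pi x.
Proof. by move=> lv; apply/torus_piP; rewrite addrAC subrr add0r. Qed.

Lemma torus_pi_surj (p : torus R) : exists x, torus_pi x = p.
Proof. by exists (repr p); exact: reprK. Qed.

Lemma lattice_reduce x :
  exists2 v, lattice v & (0 <= (x - v).1 <= 1) && (0 <= (x - v).2 <= 1).
Proof.
exists ((Num.floor x.1)%:~R, (Num.floor x.2)%:~R).
  by apply/andP; split; exact: intr_int.
rewrite /= !subr_ge0 !Num.Theory.floor_le !lerBlDr /=.
by apply/andP; split; rewrite addrC -[1]/(1%:~R) -intrD; apply/ltW/floorD1_gt.
Qed.

Lemma lattice_reduce_norm x : exists2 v, lattice v & `|x - v| <= 1.
Proof.
have [v lv /andP[/andP[a b] /andP[c d]]] := lattice_reduce x; exists v => //.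
by rewrite norm_pair_le !ger0_norm // b d.
Qed.

Lemma lattice_norm_lt1 v : lattice v -> `|v| < 1 -> v = 0.
Proof.
move=> /andP[/intrP[m mE] /intrP[n nE]]; rewrite norm_pair_lt mE nE.
rewrite -!intr_norm -[1]/(1%:~R) !ltr_int => /andP[m1 n1].
have m0 : m = 0 by move: m1; clear; lia.
have n0 : n = 0 by move: n1; clear; lia.
by rewrite (surjective_pairing v) mE nE m0 n0.
Qed.

(** The difference is continuous with values in the lattice, hence constant. It need not be [v]: a
    general lift may act nontrivially on the lattice. *)
Lemma lift_translation (g : torus R -> torus R) h v x y :
  is_lift g h -> lattice v ->
  lattice (h (x + v) - h x) /\ h (x + v) - h x = h (y + v) - h y.
Proof.
move=> [hc hl] lv.
have lat z : lattice (h (z + v) - h z).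
  apply/torus_piP; have /= := congr1 (fun k => k (z + v)) hl => ->.
  by rewrite torus_piD// -[RHS]/((@torus_pi R \o h) z) hl.
split=> //.
have dc : continuous (fun z : R * R => h (z + v) - h z).
  move=> z; apply: cvgB; last exact: hc.
  apply: (@continuous_comp _ _ _ (fun z : R * R => z + v) h); last exact: hc.
  by apply: cvgD; [exact: cvg_id|exact: cvg_cst].
have E1 : (h (x + v) - h x).1 = (h (y + v) - h y).1.
  apply: (@int_valued_constant R (fun z => (h (z + v) - h z).1) x y).
    by move=> z; exact: (@cvg_comp _ _ _ _ fst _ _ _ (dc z) cvg_fst).
  by move=> z; have /andP[] := lat z.
have E2 : (h (x + v) - h x).2 = (h (y + v) - h y).2.
  apply: (@int_valued_constant R (fun z => (h (z + v) - h z).2) x y).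
    by move=> z; exact: (@cvg_comp _ _ _ _ snd _ _ _ (dc z) cvg_snd).
  by move=> z; have /andP[] := lat z.
by rewrite [LHS]surjective_pairing E1 E2 -surjective_pairing.
Qed.

Definition equivariant h :=
  continuous h /\ forall x v, lattice v -> h (x + v) = h x + v.

Lemma periodic_bounded h : continuous h ->
  (forall x v, lattice v -> h (x + v) = h x) -> exists M, forall x, `|h x| <= M.
Proof.
move=> hc hp.
have : compact (h @` (`[0, 1]%classic `*` `[0, 1]%classic)).
  apply: continuous_compact; first exact: continuous_subspaceT.
  by apply: compact_setX; exact: segment_compact.
move=> /compact_bounded[M [_ HM]]; exists (M + 1) => x.
have [v lv H] := lattice_reduce x.
rewrite -(hp x (- v)); last exact: latticeN.
apply: (HM (M + 1)); first by rewrite ltrDl.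
by exists (x - v) => //; move: H; rewrite /= !in_itv /= => /andP.
Qed.

Lemma equivariant_disp_bounded h : equivariant h ->
  exists M, forall x, `|h x - x| <= M.
Proof.
move=> [hc hv]; apply: (@periodic_bounded (fun x : R * R => h x - x)).
  by move=> x; apply: cvgB; [exact: hc|exact: cvg_id].
by move=> x v lv; rewrite hv// opprD addrACA subrr addr0.
Qed.

Lemma natSinv_lt (e : R) : 0 < e ->
  exists N, forall n, (N <= n)%N -> n.+1%:R^-1 < e.
Proof.
move=> e0; have [N _ HN] := near_infty_natSinv_lt (PosNum e0).
by exists N => n Nn; exact: HN.
Qed.

Lemma cvgn_comp_dist (s : nat -> nat) (u : nat -> R * R) (l : R * R) h (e : R) :
  continuous h -> u \o s @ \oo --> l -> 0 < e ->
  exists N, forall n, (N <= n)%N -> `|h l - h (u (s n))| < e.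
Proof.
move=> hc ul e0.
have /cvgn_distP/(_ e e0)[N HN] : h \o (u \o s) @ \oo --> h l.
  by apply: cvg_comp ul (hc l).
by exists N.
Qed.

(** Sequential compactness: subtracting one lattice vector from both points brings the first into
    the unit ball. *)
Lemma equivariant_unif_continuous h (e : R) : equivariant h -> 0 < e ->
  exists2 d, 0 < d & forall x y, `|x - y| < d -> `|h x - h y| < e.
Proof.
move=> [hc hv] e0; apply: contrapT => H.
have {H} /choice[p Hp] : forall k : nat, exists p : (R * R) * (R * R),
    [/\ `|p.1| <= 1, `|p.1 - p.2| < k.+1%:R^-1 & e <= `|h p.1 - h p.2|].
  move=> k; apply: contrapT => Hk; apply: H.
  exists k.+1%:R^-1; first by rewrite invr_gt0 ltr0n.
  move=> x y xy; rewrite ltNge; apply/negP => exy; apply: Hk.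
  have [v lv xv] := lattice_reduce_norm x.
  exists (x - v, y - v); split=> //=; first by rewrite opprB addrA subrK.
  by rewrite !hv ?latticeN// opprB addrA subrK.
have [|s si [l Hl]] := @bolzano_weierstrass_pair R (fst \o p) 1.
  by move=> n; case: (Hp n).
have e2 : 0 < e / 4 by rewrite divr_gt0.
have [d /= d0 Hd] : exists2 d, 0 < d & forall x, `|l - x| < d -> `|h l - h x| < e / 4.
  have /cvgrPdist_lt/(_ _ e2) := hc l.
  rewrite near_simpl => /nbhs_normP[d /= d0 Hd]; exists d => // x lx; exact: Hd.
have d2 : 0 < d / 2 by rewrite divr_gt0.
have /cvgn_distP/(_ _ d2)[N1 HN1] := Hl.
have [N2 HN2] := natSinv_lt d2.
pose n := maxn N1 N2.
have n1 := HN1 n (leq_maxl _ _).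
have n2 : (s n).+1%:R^-1 < d / 2.
  by apply: HN2; apply: leq_trans (leq_homo_ltn si n); exact: leq_maxr.
have [_ pn pe] := Hp (s n).
have a1 : `|h l - h (p (s n)).1| < e / 4.
  apply: Hd; apply: lt_trans n1 _; lra.
have a2 : `|h l - h (p (s n)).2| < e / 4.
  apply: Hd; rewrite -(subrKA (p (s n)).1).
  apply: le_lt_trans (pair_normD _ _) _.
  by rewrite [ltRHS]splitr; exact: ltrD n1 (lt_trans pn n2).
have : `|h (p (s n)).1 - h (p (s n)).2| < e.
  rewrite -(subrKA (h l)); apply: le_lt_trans (pair_normD _ _) _.
  rewrite pair_distC; lra.
by rewrite ltNge pe.
Qed.

(** This stands in for uniform continuity of the inverse. Bad pairs are again translated into a
    bounded region, and their limits would be distinct points with the same image. *)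
Lemma equivariant_unif_injective h (e : R) : equivariant h -> injective h ->
  0 < e -> exists2 d, 0 < d & forall x y, `|h x - h y| < d -> `|x - y| < e.
Proof.
move=> heq hinj e0; have [hc hv] := heq.
have [M HM] := equivariant_disp_bounded heq.
apply: contrapT => H.
have {H} /choice[p Hp] : forall k : nat, exists p : (R * R) * (R * R),
    [/\ `|p.1| <= 1, `|h p.1 - h p.2| < k.+1%:R^-1 & e <= `|p.1 - p.2|].
  move=> k; apply: contrapT => Hk; apply: H.
  exists k.+1%:R^-1; first by rewrite invr_gt0 ltr0n.
  move=> x y xy; rewrite ltNge; apply/negP => exy; apply: Hk.
  have [v lv xv] := lattice_reduce_norm x.
  exists (x - v, y - v); split=> //=; last by rewrite opprB addrA subrK.
  by rewrite !hv ?latticeN// opprB addrA subrK.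
have [|s si [l Hl]] := @bolzano_weierstrass_pair R (fst \o p) 1.
  by move=> n; case: (Hp n).
have [|t ti [m Hm]] := @bolzano_weierstrass_pair R (snd \o p \o s) (2 + 2 * M).
  move=> n; have [p1 p2 _] := Hp (s n); rewrite /=.
  have : (s n).+1%:R^-1 <= 1 :> R by rewrite invf_le1 ?ler1n ?ltr0n.
  have := HM (p (s n)).1; have := HM (p (s n)).2.
  move: p1 p2; set a := (p (s n)).1; set b := (p (s n)).2 => p1 p2 p3 p4 p5.
  have -> : b = a + ((h a - a) + ((b - h b) - (h a - h b))) by ring.
  have n1 := pair_normD a ((h a - a) + ((b - h b) - (h a - h b))).
  have n2 := pair_normD (h a - a) ((b - h b) - (h a - h b)).
  have n3 := pair_normB (b - h b) (h a - h b).
  rewrite [`|b - h b|]pair_distC in n3.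
  have p6 := lt_le_trans p2 p5.
  apply: (le_trans n1); lra.
have lm : l != m.
  apply/eqP => lm.
  have e2 : 0 < e / 2 by rewrite divr_gt0.
  have /cvgn_distP/(_ _ e2)[N1 HN1] := Hl.
  have /cvgn_distP/(_ _ e2)[N2 HN2] := Hm.
  pose n := maxn N1 N2.
  have n1 := HN1 (t n) (leq_trans (leq_maxl _ _) (leq_homo_ltn ti n)).
  have n2 := HN2 n (leq_maxr _ _).
  have [_ _ pe] := Hp (s (t n)).
  suff : `|(p (s (t n))).1 - (p (s (t n))).2| < e by rewrite ltNge pe.
  rewrite -(subrKA l); apply: le_lt_trans (pair_normD _ _) _.
  rewrite pair_distC {2}lm; move: n1 n2 => /=; lra.
case/eqP: lm; apply: hinj; apply/eqP; rewrite -subr_eq0 -normr_le0 leNgt.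
apply/negP => k0; set k := `|_| in k0.
have k3 : 0 < k / 3 by rewrite divr_gt0.
have [N1 HN1] := cvgn_comp_dist hc Hl k3.
have [N2 HN2] := cvgn_comp_dist hc Hm k3.
have [N3 HN3] := natSinv_lt k3.
pose n := maxn N1 (maxn N2 N3).
have n1 := HN1 (t n) (leq_trans (leq_maxl _ _) (leq_homo_ltn ti n)).
have n2 : (N2 <= n)%N by rewrite /n !leq_max leqnn orbT.
have {}n2 := HN2 n n2.
have n3 : (N3 <= s (t n))%N.
  apply: leq_trans (leq_homo_ltn si _); apply: leq_trans (leq_homo_ltn ti _).
  by rewrite /n !leq_max leqnn !orbT.
have {}n3 := HN3 _ n3.
have [_ p2 _] := Hp (s (t n)).
have {n3}p2' := lt_trans p2 n3.
suff : k < k by rewrite ltxx.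
rewrite {1}/k.
move: n1 n2 p2' => /=; set a := h (p _).1; set b := h (p _).2 => n1 n2 p2'.
have -> : h l - h m = (h l - a) + ((a - b) - (h m - b)) by ring.
apply: le_lt_trans (pair_normD _ _) _.
by have := pair_normB (a - b) (h m - b); lra.
Qed.

End Lattice.

(** * Consequences of having a single rotation vector *)

Section Rotation.
Variables (R : realType) (f : torus R -> torus R) (F : R * R -> R * R).
Variable rho : R * R.
Hypothesis Flift : is_lift f F.
Hypothesis Frho : rotation_set F = [set rho].

Let mean (n : nat) (z : R * R) : R * R := n%:R^-1 *: (iter n F z - z).

(** By compactness the means accumulate at a vector of the rotation set, which can only be [rho]. *)
Lemma rotation_vector_unique (n : nat -> nat) (z : nat -> R * R) (c e : R) :
  {homo n : i j / (i < j)%N} -> 0 < e ->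
  (forall i, `|mean (n i) (z i) - rho| <= c) ->
  (forall i, e <= `|mean (n i) (z i) - rho|) -> False.
Proof.
move=> ni e0 Hc He.
have [|s si [l Hl]] :=
  @bolzano_weierstrass_pair R (fun i => mean (n i) (z i)) (c + `|rho|).
  move=> i; have := pair_normD (mean (n i) (z i) - rho) rho.
  by rewrite subrK; have := Hc i; lra.
have : rotation_set F l.
  exists (n \o s), (z \o s); split=> // i j ij.
  exact: ni (si _ _ ij).
rewrite Frho => lrho.
have /cvgn_distP/(_ e e0)[N /(_ N (leqnn N)) HN] := Hl.
have := He (s N); rewrite pair_distC -lrho leNgt.
by move/negP; apply.
Qed.

Lemma lift_iter (n : nat) : is_lift (iter n f) (iter n F).
Proof.
have [Fc Fl] := Flift.
elim: n => [|n [IHc IHl]]; first by split=> // x; exact: cvg_id.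
split=> [x|].
  by apply: (@continuous_comp _ _ _ (iter n F) F); [exact: IHc|exact: Fc].
apply/funext => x /=; rewrite -[LHS]/((@torus_pi R \o F) _) Fl /=.
by rewrite -[torus_pi (iter n F x)]/((@torus_pi R \o iter n F) x) IHl.
Qed.

Lemma iter_lift_Mn (n k : nat) (x v : R * R) : lattice v ->
  iter n F (x + v *+ k) = iter n F x + (iter n F v - iter n F 0) *+ k.
Proof.
move=> lv; elim: k => [|k IH]; first by rewrite !mulr0n !addr0.
have [_] := lift_translation (x + v *+ k) 0 (lift_iter n) lv.
rewrite add0r => E.
set d := iter n F v - iter n F 0 in IH E *.
clearbody d.
by rewrite !mulrSr !addrA -IH -E [RHS]addrC subrK.
Qed.

Lemma deck_transformation_trivial (n : nat -> nat) (z : nat -> R * R) (c : R) :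
  {homo n : i j / (i < j)%N} -> (forall i, (0 < n i)%N) ->
  (forall i, `|mean (n i) (z i) - rho| <= c) ->
  exists i, forall v, lattice v -> iter (n i) F v = iter (n i) F 0 + v.
Proof.
move=> ni n0 Hc; apply: contrapT => H.
have c0 : 0 <= c by apply: le_trans (Hc 0%N).
(* Fixing the distance at [c + 1] keeps these means both bounded and away from [rho]. *)
have {H} /choice[z' Hz'] : forall i, exists z',
    `|mean (n i) z' - rho| = c + 1.
  move=> i; apply: contrapT => Hi; apply: H; exists i => v lv.
  apply: contrapT => Gv; apply: Hi.
  set G := iter (n i) F in Gv.
  pose w := G v - G 0 - v.
  have lw : lattice w.
    apply: latticeB => //.
    by have [+ _] := lift_translation 0 0 (lift_iter (n i)) lv; rewrite add0r.
  have w1 : 1 <= `|w|.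
    rewrite leNgt; apply/negP => /(lattice_norm_lt1 lw) w0; apply: Gv.
    by rewrite -(subrK (G 0) (G v)) -(subrK v (G v - G 0)) -/w w0 add0r addrC.
  have nR : 0 < (n i)%:R :> R by rewrite ltr0n.
  (* With [k / n i > 2 * c + 1] and [w] of norm at least 1, moving from [z i] to [z i + v *+ k]
     carries the mean beyond distance [c + 1]. *)
  pose k := Num.bound ((n i)%:R * (2 * c + 1)).
  have kb : (n i)%:R * (2 * c + 1) < k%:R.
    by apply: archi_boundP; rewrite mulr_ge0// addr_ge0// mulr_ge0.
  have gc : continuous (fun x : R * R => `|mean (n i) x - rho|).
    move=> x; apply: cvg_norm; apply: cvgB; last exact: cvg_cst.
    apply: cvgZl_tmp; apply: cvgB; last exact: cvg_id.
    by have [Gc _] := lift_iter (n i); exact: Gc.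
  have [||t _ Ht] := @ivt_segment R _ (z i) (v *+ k) (c + 1) gc.
  - by apply: le_trans (Hc i) _; rewrite lerDl.
  - have -> : mean (n i) (z i + v *+ k) - rho =
        (mean (n i) (z i) - rho) + ((n i)%:R^-1 * k%:R) *: w.
      rewrite /mean iter_lift_Mn// -/G -scalerA scaler_nat [RHS]addrAC -scalerDr.
      by congr (_ *: _ - _); rewrite [w *+ k]mulrnBl opprD addrACA.
    have := pair_normB ((mean (n i) (z i) - rho) + ((n i)%:R^-1 * k%:R) *: w)
      (mean (n i) (z i) - rho).
    rewrite addrAC subrr add0r pair_normZ ger0_norm ?mulr_ge0 ?invr_ge0//.
    have : 2 * c + 1 < (n i)%:R^-1 * k%:R by rewrite -ltr_pdivrMl ?invr_gt0// invrK.
    move=> H1 H2.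
    have : (n i)%:R^-1 * k%:R <= (n i)%:R^-1 * k%:R * `|w|.
      by rewrite ler_peMr// mulr_ge0 ?invr_ge0.
    by have := Hc i; lra.
  - by exists (z i + t *: (v *+ k)).
apply: (@rotation_vector_unique n z' (c + 1) (c + 1) ni).
- by lra.
- by move=> i; rewrite Hz'.
- by move=> i; rewrite Hz'.
Qed.

Lemma equivariant_iter (h : R * R -> R * R) (n : nat) :
  equivariant h -> equivariant (iter n h).
Proof.
move=> [hc hv]; elim: n => [|n [IHc IHv]]; first by split=> // x; exact: cvg_id.
split=> [x|x v lv /=]; last by rewrite IHv// hv.
by apply: (@continuous_comp _ _ _ (iter n h) h); [exact: IHc|exact: hc].
Qed.

Lemma iter_disp (h : R * R -> R * R) (M : R) (n : nat) (x : R * R) :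
  (forall x, `|h x - x| <= M) -> `|iter n h x - x| <= n%:R * M.
Proof.
move=> hM; elim: n => [|n IH]; first by rewrite subrr normr0 mul0r.
have := pair_dist_triangle (iter n.+1 h x) (iter n h x) x.
rewrite -natr1 mulrDl mul1r; have := hM (iter n h x) => /=; lra.
Qed.

Lemma lift_equivariantP (n : nat) :
  (forall v, lattice v -> iter n F v = iter n F 0 + v) -> equivariant (iter n F).
Proof.
move=> H; split; first by have [] := lift_iter n.
move=> x v lv; have [_] := lift_translation x 0 (lift_iter n) lv.
by rewrite add0r (H v lv) [_ + v - _]addrAC subrr add0r => E; rewrite -[in RHS]E [RHS]addrC subrK.
Qed.

(* A nontrivial deck action would, by the intermediate value theorem along a
   long lattice segment, produce mean displacements at a prescribed distance
   from rho. This is applied first along the times realizing rho, which gives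
   some iterate N acting trivially, and then along the times kN + 1. *)
Lemma lift_equivariant : equivariant F.
Proof.
have [n [z [ni nz]]] : rotation_set F rho by rewrite Frho.
have /cvgn_distP/(_ 1 ltr01)[N HN] := nz.
have [||i|i Hi] := @deck_transformation_trivial (fun i => n (i + N.+1)%N)
  (fun i => z (i + N.+1)%N) 1.
- by move=> i j ij; apply: ni; rewrite ltn_add2r.
- by move=> i; apply: leq_ltn_trans (leq0n _) (ni 0%N _ _); rewrite addnS.
- by rewrite pair_distC; apply/ltW/HN; rewrite addnS ltnW// ltnS leq_addl.
set N0 := n _ in Hi.
have Geq := lift_equivariantP Hi.
have [M HM] := equivariant_disp_bounded Geq.
have M0 : 0 <= M by apply: le_trans (HM 0).
(* Displacements of [iter N0 F] are bounded, so the means at 0 along these times are bounded as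
   well. *)
have [|i'|i'|k Hk] := @deck_transformation_trivial
    (fun i => (i.+1 * N0).+1)%N (fun=> 0) (M + `|F 0| + `|rho|).
- have N0p : (0 < N0)%N.
    by apply: leq_ltn_trans (leq0n _) (ni 0%N _ _); rewrite addnS.
  by move=> i1 i2 ij; rewrite ltnS ltn_mul2r N0p.
- by [].
- apply: le_trans (pair_normB _ _) _; rewrite lerD2r.
  rewrite /mean subr0 iterSr iterM pair_normZ ger0_norm ?invr_ge0//.
  rewrite ler_pdivrMl ?ltr0n//.
  have := pair_normD (iter i'.+1 (iter N0 F) (F 0) - F 0) (F 0); rewrite subrK.
  move=> /le_trans; apply; rewrite mulrDr; apply: lerD.
    apply: le_trans (iter_disp _ _ HM) _; rewrite ler_wpM2r// ler_nat.
    rewrite ltnW// ltnS leq_pmulr//.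
    by apply: leq_ltn_trans (leq0n _) (ni 0%N _ _); rewrite addnS.
  by rewrite ler_peMl// ler1n.
(* The iterate [k.+1 * N0] commutes with the lattice vector [F v - F 0]; comparison with [Hk] gives
   [F v - F 0 = v]. *)
have [_ Gv] := equivariant_iter k.+1 Geq.
apply: (@lift_equivariantP 1) => v lv /=.
have := Hk v lv; rewrite !iterSr !iterM.
have [la _] := lift_translation 0 0 (lift_iter 1) lv.
rewrite /= add0r in la.
rewrite -{1}(subrK (F 0) (F v)) addrC Gv// => /addrI E.
by rewrite -{1}(subrK (F 0) (F v)) E addrC.
Qed.

(** Otherwise bad pairs occur at arbitrarily large times, and a strictly increasing selection of
    them contradicts [rotation_vector_unique]. *)
Lemma mean_cvg_uniform (e : R) : 0 < e ->
  exists N, forall n z, (N <= n)%N -> `|mean n z - rho| < e.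
Proof.
move=> e0; apply: contrapT => H.
have {H}/choice[g Hg] : forall N, exists p : nat * (R * R),
    (N <= p.1)%N /\ e <= `|mean p.1 p.2 - rho|.
  move=> N; apply: contrapT => HN; apply: H; exists N => n z Nn.
  by rewrite ltNge; apply/negP => He; apply: HN; exists (n, z).
(* Each time is chosen beyond the previous one; [a \o S] below omits the initial time 0. *)
pose a i := iter i (fun m => (g m.+1).1) 0%N.
have aS i : (a i < a i.+1)%N by have [] := Hg (a i).+1.
have ai : {homo a : i j / (i < j)%N} by apply: homo_ltn aS => ? ? ?; exact: ltn_trans.
have [M HM] := equivariant_disp_bounded lift_equivariant.
have M0 : 0 <= M by apply: le_trans (HM 0).
apply: (@rotation_vector_unique (a \o S) (fun i => (g (a i).+1).2)
  (M + `|rho|) e) => //.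
- by move=> i j ij; apply: ai.
- move=> i; apply: le_trans (pair_normB _ _) _; rewrite lerD2r /mean.
  have n0 : (0 < (a \o S) i)%N by apply: leq_ltn_trans (aS i).
  rewrite pair_normZ ger0_norm ?invr_ge0// ler_pdivrMl ?ltr0n//.
  exact: iter_disp.
- by move=> i; have [] := Hg (a i).+1.
Qed.

(* Cut the orbit segment of length kn into k blocks of length n, and let k
   tend to infinity. *)
Lemma uniform_disp_bounded (C : R) :
  (forall n y z, `|(iter n F y - y) - (iter n F z - z)| <= C) ->
  forall n z, `|iter n F z - z - n%:R *: rho| <= C.
Proof.
move=> HC n z.
have C0 : 0 <= C by apply: le_trans (HC 0%N 0 0).
have [->|n0] := posnP n; first by rewrite scale0r subr0 subrr normr0.
set w := iter n F z - z.
have nR : 0 < n%:R :> R by rewrite ltr0n.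
have drift k : `|iter (k * n) F z - z - k%:R *: w| <= k%:R * C.
  elim: k => [|k IH]; first by rewrite mul0n scale0r subr0 subrr normr0 mul0r.
  rewrite mulSn iterD -natr1 scalerDl scale1r mulrDl mul1r.
  set p := iter (k * n) F z in IH *.
  have -> : iter n F p - z - (k%:R *: w + w) =
      ((iter n F p - p) - w) + (p - z - k%:R *: w).
    by ring.
  have := pair_normD ((iter n F p - p) - w) (p - z - k%:R *: w).
  have := HC n p z; rewrite -/w; lra.
rewrite leNgt; apply/negP => Cw.
(* With this accuracy the mean over [N.+1] blocks, which [drift] puts within [C / n] of [w / n],
   would be strictly too close to [rho]. *)
have e0 : 0 < (`|w - n%:R *: rho| - C) / n%:R by rewrite divr_gt0// subr_gt0.
have [N HN] := mean_cvg_uniform e0.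
have := HN (N.+1 * n)%N z; rewrite (leq_trans (leqnSn N)) ?leq_pmulr// => /(_ isT).
have kR : 0 < N.+1%:R :> R by rewrite ltr0n.
rewrite /mean; set d := iter (N.+1 * n) F z - z in drift *.
have := drift N.+1; rewrite -/d => D1 D2.
have D3 : `|d - (N.+1 * n)%:R *: rho| < N.+1%:R * (`|w - n%:R *: rho| - C).
  have -> : d - (N.+1 * n)%:R *: rho =
      (N.+1 * n)%:R *: ((N.+1 * n)%:R^-1 *: d - rho).
    by rewrite scalerBr scalerA divff ?scale1r// pnatr_eq0 muln_eq0 -lt0n n0.
  rewrite pair_normZ ger0_norm// natrM -mulrA ltr_pM2l// mulrC -ltr_pdivlMr//.
  by rewrite -natrM.
have := pair_dist_triangle (N.+1%:R *: w) d ((N.+1 * n)%:R *: rho).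
rewrite natrM -scalerA -scalerBr pair_normZ ger0_norm//.
rewrite scalerA -natrM pair_distC.
move: D3; rewrite mulrBr; lra.
Qed.

End Rotation.

(** * Chains, and coordinates along and across a vector *)

Section Chains.
Variable R : realType.
Implicit Types (p q r x y u z : R * R) (P Q : R * R -> Prop).

(** Both conditions hold at every index, also beyond [N], so that a chain can be fed directly to
    [approximate_zero]. *)
Definition chain P (eta : R) p q := exists N (a : nat -> R * R),
  [/\ a 0%N = p, a N = q, forall i, `|a i - a i.+1| < eta & forall i, P (a i)].

Lemma chain_refl P eta p : 0 < eta -> P p -> chain P eta p p.
Proof. by move=> e0 Pp; exists 0%N, (fun=> p); split=> // i; rewrite subrr normr0. Qed.

Lemma chain_trans P eta p q r :
  chain P eta p q -> chain P eta q r -> chain P eta p r.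
Proof.
move=> [N [a [a0 aN aS aP]]] [M [b [b0 bM bS bP]]].
exists (N + M)%N, (fun i => if (i <= N)%N then a i else b (i - N)%N); split=> //.
- case: leqP => [|_]; last by rewrite addKn.
  by rewrite -{2}[N]addn0 leq_add2l leqn0 => /eqP M0; rewrite M0 addn0 aN -b0 -M0.
- move=> i; case: (ltngtP i N) => iN.
  + exact: aS.
  + by rewrite (subSn (ltnW iN)); exact: bS.
  + by rewrite iN aN -b0 subSn// subnn; exact: bS.
- by move=> i; case: ifP.
Qed.

Lemma chain_sym P eta p q : 0 < eta -> chain P eta p q -> chain P eta q p.
Proof.
move=> e0 [N [a [a0 aN aS aP]]]; exists N, (fun i => a (N - i)%N).
split=> //; [by rewrite subn0|by rewrite subnn|move=> i].
have [iN|Ni] := ltnP i N.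
  by rewrite pair_distC -(subnSK iN).
have /eqP -> : (N - i == 0)%N by rewrite subn_eq0.
have /eqP -> : (N - i.+1 == 0)%N by rewrite subn_eq0 ltnW.
by rewrite subrr normr0.
Qed.

Lemma chain_map P Q eta d (h : R * R -> R * R) p q :
  (forall x y, `|x - y| < d -> `|h x - h y| < eta) ->
  (forall x, P x -> Q (h x)) -> chain P d p q -> chain Q eta (h p) (h q).
Proof.
move=> hd hP [N [a [<- <- aS aP]]]; exists N, (h \o a).
by split=> // i /=; [exact/hd/aS|exact/hP/aP].
Qed.

Lemma sub_chain P Q eta p q :
  (forall x, P x -> Q x) -> chain P eta p q -> chain Q eta p q.
Proof. by move=> PQ; apply: (@chain_map P Q eta eta id). Qed.

Lemma chain_segment P eta p q : 0 < eta ->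
  (forall t, 0 <= t <= 1 -> P (p + t *: q)) -> chain P eta p (p + q).
Proof.
move=> e0 H; pose N := (Num.bound (`|q| / eta)).+1.
have N0 : 0 < N%:R :> R by rewrite ltr0n.
have qN : `|q| < eta * N%:R.
  rewrite mulrC -ltr_pdivrMr//; apply: lt_trans (archi_boundP _) _.
    by rewrite divr_ge0// ltW.
  by rewrite ltr_nat.
pose t i : R := (minn i N)%:R / N%:R.
exists N, (fun i => p + t i *: q); split.
- by rewrite /t min0n mul0r scale0r addr0.
- by rewrite /t minnn divff ?scale1r// gt_eqF.
- move=> i; rewrite opprD addrACA subrr add0r -scalerBl pair_normZ /t.
  have [iN|Ni] := ltnP i N.
    rewrite (minn_idPl iN) -mulrBl -natr1 opprD addrA subrr.
    rewrite add0r mulN1r normrN ger0_norm ?invr_ge0 ?ltW//.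
    by rewrite ltr_pdivrMl// mulrC.
  rewrite (minn_idPr (leq_trans Ni (leqnSn i))).
  by rewrite subrr normr0 mul0r.
- move=> i; apply: H; rewrite divr_ge0//= ler_pdivrMr// mul1r ler_nat.
  exact: geq_minr.
Qed.

(** Up to the Euclidean length of [u], this is the signed height of [x] above the line spanned by
    [u]; [dot] is the coordinate along that line. *)
Definition cross u x := u.1 * x.2 - u.2 * x.1.
Definition dot u x := u.1 * x.1 + u.2 * x.2.

Lemma pair_fstD x y : (x + y).1 = x.1 + y.1. Proof. by []. Qed.
Lemma pair_sndD x y : (x + y).2 = x.2 + y.2. Proof. by []. Qed.
Lemma pair_fstN x : (- x).1 = - x.1. Proof. by []. Qed.
Lemma pair_sndN x : (- x).2 = - x.2. Proof. by []. Qed.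
Lemma pair_fstZ (t : R) x : (t *: x).1 = t * x.1. Proof. by []. Qed.
Lemma pair_sndZ (t : R) x : (t *: x).2 = t * x.2. Proof. by []. Qed.
Definition pair_linE := (pair_fstD, pair_sndD, pair_fstN, pair_sndN,
  pair_fstZ, pair_sndZ).

Lemma norm_fst_le x : `|x.1| <= `|x|.
Proof. by rewrite prod_normE le_max lexx. Qed.

Lemma norm_snd_le x : `|x.2| <= `|x|.
Proof. by rewrite prod_normE le_max lexx orbT. Qed.

Lemma cross_le u x : `|cross u x| <= 2 * `|u| * `|x|.
Proof.
have := ler_normB (u.1 * x.2) (u.2 * x.1); rewrite !normrM.
have := ler_pM (normr_ge0 _) (normr_ge0 _) (norm_fst_le u) (norm_snd_le x).
have := ler_pM (normr_ge0 _) (normr_ge0 _) (norm_snd_le u) (norm_fst_le x).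
rewrite /cross; lra.
Qed.

Lemma dot_le u x : `|dot u x| <= 2 * `|u| * `|x|.
Proof.
have := ler_normD (u.1 * x.1) (u.2 * x.2); rewrite !normrM.
have := ler_pM (normr_ge0 _) (normr_ge0 _) (norm_fst_le u) (norm_fst_le x).
have := ler_pM (normr_ge0 _) (normr_ge0 _) (norm_snd_le u) (norm_snd_le x).
rewrite /dot; lra.
Qed.

Lemma lattice_sqr_ge1 u : lattice u -> u != 0 -> 1 <= u.1 ^+ 2 + u.2 ^+ 2.
Proof.
move=> lu u0; rewrite leNgt; apply/negP => lt1.
case/eqP: u0; apply: lattice_norm_lt1 => //.
have sq1 (s : R) : s ^+ 2 < 1 -> `|s| < 1.
  move=> s1; rewrite ltNge; apply/negP => H; move: s1.
  by rewrite -real_normK ?num_real// expr2 ltNge mulr_ege1.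
have a := sqr_ge0 u.1; have b := sqr_ge0 u.2.
by rewrite norm_pair_lt !sq1//; lra.
Qed.

(** The vector [D *: x] is the combination of [u] and its quarter turn with coefficients [dot u x]
    and [cross u x]. Integrality bounds the sum of the absolute values of [u.1] and [u.2] by [D], so
    the bound [k] is not worsened. *)
Lemma le_of_dot_cross u x (k : R) : lattice u -> u != 0 ->
  `|dot u x| <= k -> `|cross u x| <= k -> `|x| <= k.
Proof.
move=> lu u0 Hd Hc.
have k0 : 0 <= k by apply: le_trans Hd.
have D1 := lattice_sqr_ge1 lu u0.
set D := u.1 ^+ 2 + u.2 ^+ 2 in D1.
have intsq (s : R) : s \is a Num.int -> `|s| <= s ^+ 2.
  move=> /intrP[m ->]; rewrite -intr_norm -rmorphXn /= ler_int.
  by clear; nia.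
have [/intsq u1 /intsq u2] := andP lu.
have bnd (a b c : R) : `|a| <= k -> `|b| <= k ->
    D * c = u.1 * a + u.2 * b \/ D * c = u.2 * a + u.1 * b -> `|c| <= k.
  move=> Ha Hb E.
  suff : D * `|c| <= D * k by rewrite ler_pM2l//; apply: lt_le_trans D1.
  rewrite -{1}[D]ger0_norm; last by apply: le_trans D1.
  have key (s t : R) : `|s| + `|t| <= D -> `|s * a + t * b| <= D * k.
    move=> st; apply: le_trans (ler_normD _ _) _; rewrite !normrM.
    have := ler_wpM2l (normr_ge0 s) Ha; have := ler_wpM2l (normr_ge0 t) Hb.
    by have := ler_wpM2r k0 st; rewrite mulrDl; lra.
  rewrite -normrM; case: E => ->; apply: key; rewrite /D; lra.
rewrite norm_pair_le; apply/andP; split.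
- apply: (bnd (dot u x) (- cross u x)); rewrite ?normrN//.
  by left; rewrite /D /dot /cross; ring.
- apply: (bnd (dot u x) (cross u x)) => //.
  by right; rewrite /D /dot /cross; ring.
Qed.

End Chains.

(** * Linked points, periods and barriers *)

Section Links.
Variables (R : realType) (F : R * R -> R * R).
Hypothesis Feq : equivariant F.
Hypothesis Finj : injective F.
Implicit Types (p q r x y u v z : R * R).

Let Fn_eq n : equivariant (iter n F) := equivariant_iter n Feq.

(* The bound C must depend neither on the scale eta nor on the time n. *)
Definition linked p q := exists C, forall eta, 0 < eta ->
  chain (fun x => forall n, `|iter n F x - iter n F p| <= C) eta p q.

Lemma linked_trans p q r : linked p q -> linked q r -> linked p r.
Proof.
move=> [C HC] [D HD].
have qp n : `|iter n F q - iter n F p| <= C.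
  by have [N [a [_ <- _]]] := HC 1 ltr01; apply.
have D0 : 0 <= D.
  have [N [a [_ _ _ /(_ 0%N 0%N)]]] := HD 1 ltr01.
  by move=> H; apply: le_trans H.
exists (C + D) => eta e0; apply: (@chain_trans _ _ _ _ q).
  apply: sub_chain (HC eta e0) => x Hx n.
  by apply: le_trans (Hx n) _; rewrite lerDl.
apply: sub_chain (HD eta e0) => x Hx n.
have := pair_dist_triangle (iter n F x) (iter n F q) (iter n F p).
by have := Hx n; have := qp n; lra.
Qed.

Lemma linked_sym p q : linked p q -> linked q p.
Proof.
move=> [C HC].
have qp n : `|iter n F q - iter n F p| <= C.
  by have [N [a [_ <- _]]] := HC 1 ltr01; apply.
exists (C + C) => eta e0; apply: chain_sym => //.
apply: sub_chain (HC eta e0) => x Hx n.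
have := pair_dist_triangle (iter n F x) (iter n F p) (iter n F q).
have := Hx n; have := qp n; rewrite [`|iter n F q - _|]pair_distC; lra.
Qed.

Lemma linked_map p q : linked p q -> linked (F p) (F q).
Proof.
move=> [C HC]; exists C => eta e0.
have [d d0 Hd] := equivariant_unif_continuous Feq e0.
apply: chain_map Hd _ (HC d d0) => x Hx n.
by rewrite -!iterSr; exact: Hx.
Qed.

Lemma linked_iter n p q : linked p q -> linked (iter n F p) (iter n F q).
Proof. by move=> pq; elim: n => //= n IH; exact: linked_map. Qed.

Lemma linkedD v p q : lattice v -> linked p q -> linked (p + v) (q + v).
Proof.
move=> lv [C HC]; exists C => eta e0.
apply: (@chain_map _ _ _ eta eta (fun x => x + v)) (HC eta e0).
  by move=> x y; rewrite opprD addrACA subrr addr0.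
move=> x Hx n; have [_ Fv] := Fn_eq n.
by rewrite !Fv// opprD addrACA subrr addr0.
Qed.

Lemma linked_ball z (r C : R) x :
  (forall x n, `|x - z| < r -> `|iter n F x - iter n F z| <= C) ->
  `|x - z| < r -> linked z x.
Proof.
move=> H xz; exists C => eta e0.
rewrite -(subrK z x) addrC; apply: chain_segment => // t /andP[t0 t1] n.
apply: H; rewrite addrAC subrr add0r pair_normZ ger0_norm//.
by apply: le_lt_trans xz; rewrite ler_piMl.
Qed.

Lemma linked_refl p : linked p p.
Proof.
by exists 0 => eta e0; apply: chain_refl => // n; rewrite subrr normr0.
Qed.

Lemma linked_return z n v k : lattice v -> linked (iter n F z) (z + v) ->
  linked (iter (k * n) F z) (z + v *+ k).
Proof.
move=> lv H; elim: k => [|k IH].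
  by rewrite mul0n mulr0n addr0; exact: linked_refl.
rewrite mulSn iterD; apply: linked_trans (linked_iter n IH) _.
have [_ ->] := Fn_eq n; last exact: latticeMn.
by rewrite mulrS addrA; apply: linkedD => //; exact: latticeMn.
Qed.

(** Iterating both returns to the common time [m * n] links [z + v *+ m] with [z + w *+ n]. *)
Lemma linked_two_returns z n v m w : lattice v -> lattice w ->
  linked (iter n F z) (z + v) -> linked (iter m F z) (z + w) ->
  linked z (z + (v *+ m - w *+ n)).
Proof.
move=> lv lw Hv Hw.
have H1 := linked_return m lv Hv.
have H2 := linked_return n lw Hw.
have H : linked (z + w *+ n) (z + v *+ m).
  by apply: linked_trans (linked_sym H2) _; rewrite mulnC.
have /linkedD/(_ H) : lattice (- (w *+ n)) by exact/latticeN/latticeMn.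
by rewrite addrK -addrA.
Qed.

(** Translates of the chain by multiples of [u] are joined end to end. The term [c *: u] records the
    translate and is invisible to [cross u]. *)
Lemma long_chain z u (C eta : R) (K : nat) : lattice u -> 0 < eta ->
  chain (fun x => forall n, `|iter n F x - iter n F z| <= C) eta z (z + u) ->
  chain (fun x => exists c : R, forall n,
      `|iter n F x - iter n F z - c *: u| <= C) eta
    (z - u *+ K) (z + u *+ K).
Proof.
move=> lu e0 H.
have H0 : chain (fun x => exists c : R, forall n,
    `|iter n F x - iter n F z - c *: u| <= C) eta z (z + u).
  by apply: sub_chain H => x Hx; exists 0 => n; rewrite scale0r subr0.
have shift (s : R) v p q : lattice v -> v = s *: u ->
  chain (fun x => exists c : R, forall n,
      `|iter n F x - iter n F z - c *: u| <= C) eta p q ->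
  chain (fun x => exists c : R, forall n,
      `|iter n F x - iter n F z - c *: u| <= C) eta (p + v) (q + v).
  move=> lv vE; apply: (@chain_map _ _ _ eta eta (fun x => x + v)).
    by move=> x y; rewrite opprD addrACA subrr addr0.
  move=> x [c Hc]; exists (c + s) => n; have [_ ->//] := Fn_eq n.
  have -> // : iter n F x + v - iter n F z - (c + s) *: u =
    iter n F x - iter n F z - c *: u.
  by rewrite scalerDl -vE; ring.
have up k : chain (fun x => exists c : R, forall n,
    `|iter n F x - iter n F z - c *: u| <= C) eta z (z + u *+ k).
  elim: k => [|k IH].
    rewrite mulr0n addr0; apply: chain_refl => //; exists 0 => n.
    have [N [a [a0 _ _ /(_ 0%N n)]]] := H.
    by rewrite a0 scale0r subr0.
  apply: chain_trans IH _; rewrite mulrS addrA.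
  by apply: (shift k%:R) => //; [exact: latticeMn|rewrite scaler_nat].
have := up (K + K)%N => /(shift (- K%:R) (- (u *+ K)) _ _).
rewrite -addrA mulrnDr addrK; apply; first exact/latticeN/latticeMn.
by rewrite scaleNr scaler_nat.
Qed.

(* If y were below the barrier and its image above the image of the barrier,
   then the image of the downward ray from y would cross the latter. *)
Lemma barrier z u : lattice u -> u != 0 -> linked z (z + u) ->
  exists C0, forall n y, cross u y < cross u z - C0 ->
    cross u (iter n F y) <= cross u (iter n F z) + C0.
Proof.
move=> lu u0 [C HC].
pose c := 2 * `|u| * C.
have U0 : 0 < `|u| by rewrite normr_gt0.
(* [c] bounds the height of the barrier relative to the orbit of [z] at every time; 1 is the margin
   for the final contradiction. *)
exists (c + 1) => n y yz; rewrite leNgt; apply/negP => hy.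
set h := iter n F in hy.
have heq : equivariant h by exact: Fn_eq.
have hinj : injective h by rewrite /h; elim: n {hy h heq} => // n IH x1 x2 /Finj/IH.
have crossB x1 x2 : cross u (x1 - x2) = cross u x1 - cross u x2.
  by rewrite /cross !pair_linE /=; ring.
have dotB x1 x2 : dot u (x1 - x2) = dot u x1 - dot u x2.
  by rewrite /dot !pair_linE /=; ring.
have D1 := lattice_sqr_ge1 lu u0; set D := u.1 ^+ 2 + u.2 ^+ 2 in D1.
have [M HM] := equivariant_disp_bounded heq.
have crossh x : `|cross u (h x) - cross u x| <= 2 * `|u| * M.
  rewrite -crossB; apply: le_trans (cross_le _ _) _.
  by rewrite ler_pM2l ?mulr_gt0.
have doth x : `|dot u (h x) - dot u x| <= 2 * `|u| * M.
  rewrite -dotB; apply: le_trans (dot_le _ _) _.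
  by rewrite ler_pM2l ?mulr_gt0.
(* Points closer than this have heights differing by less than 1. *)
have e0 : 0 < (2 * `|u|)^-1 by rewrite invr_gt0 mulr_gt0.
have [d d0 Hd] := equivariant_unif_injective heq hinj e0.
have s0 : 0 < d / 3 / (2 * `|u|) by rewrite !divr_gt0// mulr_gt0.
have [eta eta0 Heta] := equivariant_unif_continuous heq s0.
(* The barrier is long enough for the images of its two ends to lie on opposite sides of the image
   of the ray, in the direction of [u]. *)
pose K := Num.bound (`|dot u (h z) - dot u y| + 2 * `|u| * M).
have M0 : 0 <= M by apply: le_trans (HM 0).
have UM0 : 0 <= 2 * `|u| * M by rewrite !mulr_ge0.
have HK : `|dot u (h z) - dot u y| + 2 * `|u| * M < K%:R.
  by apply: archi_boundP; rewrite addr_ge0.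
have [N [a [a0 aN aS aP]]] := long_chain K lu eta0 (HC eta eta0).
have aC i k : `|cross u (iter k F (a i)) - cross u (iter k F z)| <= c.
  have [b Hb] := aP i.
  have -> : cross u (iter k F (a i)) - cross u (iter k F z) =
      cross u (iter k F (a i) - iter k F z - b *: u).
    by rewrite /cross !pair_linE /=; ring.
  by apply: le_trans (cross_le _ _) _; rewrite ler_pM2l ?mulr_gt0.
(* The ray [g] leaves [y] orthogonally to [u], away from the barrier, in steps of norm at most
   [eta / 2]. *)
pose up : R * R := (- u.2, u.1).
pose tau := eta / (2 * `|u|).
have tau0 : 0 < tau by rewrite divr_gt0// mulr_gt0.
pose g j : R * R := y - (j%:R * tau) *: up.
have gcross j : cross u (g j) = cross u y - j%:R * tau * D.
  by rewrite /cross /g /up /D !pair_linE /=; ring.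
have gdot j : dot u (g j) = dot u y by rewrite /dot /g /up !pair_linE /=; ring.
have gS j : `|g j - g j.+1| < eta.
  have -> : g j - g j.+1 = tau *: up.
    rewrite /g -natr1 opprB addrC -addrA [- y + _]addrA [- y + y]addrC subrr add0r.
    by rewrite -scalerBl; congr (_ *: _); ring.
  have upu : `|up| <= `|u|.
    by rewrite norm_pair_le /= normrN norm_snd_le norm_fst_le.
  rewrite pair_normZ (ger0_norm (ltW tau0)).
  apply: le_lt_trans (ler_wpM2l (ltW tau0) upu) _.
  by rewrite /tau invfM mulrA mulfVK ?gt_eqF// ltr_pdivrMr// ltr_pMr//; lra.
(* The ray is long enough for the image of its end to lie below the image of the barrier. *)
pose L := Num.bound ((`|cross u y - cross u (h z)| + c + 2 * `|u| * M) / tau).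
have c0 : 0 <= c by apply: le_trans (aC 0%N 0%N).
have HL : `|cross u y - cross u (h z)| + c + 2 * `|u| * M < L%:R * tau.
  by rewrite -ltr_pdivrMr//; apply: archi_boundP; rewrite divr_ge0 ?(ltW tau0)// !addr_ge0.
have hK s : s = K%:R \/ s = - K%:R -> forall x, x = z + s *: u ->
    dot u (h x) = dot u (h z) + s * D.
  move=> sK x ->; have [_ hv] := heq.
  rewrite hv; first by rewrite /dot /D !pair_linE /=; ring.
  by case: sK => ->; rewrite ?scaleNr scaler_nat; [|apply: latticeN]; exact: latticeMn.
have KD : K%:R <= K%:R * D by rewrite ler_peMr.
have LD : L%:R * tau <= L%:R * tau * D by rewrite ler_peMr// mulr_ge0// (ltW tau0).
have step (w1 w2 : R * R) : `|w1 - w2| < d / 3 / (2 * `|u|) ->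
    `|dot u w1 - dot u w2| <= d / 3 /\ `|cross u w1 - cross u w2| <= d / 3.
  rewrite ltr_pdivlMr ?mulr_gt0// mulrC => /ltW H.
  rewrite -dotB -crossB.
  by split; [apply: le_trans (dot_le _ _) H|apply: le_trans (cross_le _ _) H].
(* The two functions compare the image of the chain with that of the ray, along [u] and across it;
   at an approximate common zero the images are [d]-close. *)
have [||||i j|i j|i j|i j|i [j [_ _ dij cij]]] := @approximate_zero R N L
    (fun i j => dot u (h (a i)) - dot u (h (g j)))
    (fun i j => cross u (h (a i)) - cross u (h (g j))) (d / 3).
- move=> j; rewrite (@hK (- K%:R)) ?a0; [|by right|by rewrite scaleNr scaler_nat].
  have := doth (g j); rewrite gdot.
  have := ler_norm (dot u (h z) - dot u y).
  by rewrite ler_norml => ? /andP[? ?]; rewrite mulNr; lra.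
- move=> j; rewrite (@hK K%:R) ?aN; [|by left|by rewrite scaler_nat].
  have := doth (g j); rewrite gdot.
  have := ler_norm (- (dot u (h z) - dot u y)); rewrite normrN.
  by rewrite ler_norml => ? /andP[? ?]; lra.
- move=> i; have := aC i n; rewrite -/h ler_norml => /andP[_ H].
  have -> : g 0%N = y by rewrite /g mul0r scale0r subr0.
  lra.
- move=> i; have := aC i n; rewrite -/h ler_norml => /andP[H _].
  have := crossh (g L); rewrite gcross ler_norml => /andP[_ ?].
  have := ler_norm (cross u y - cross u (h z)).
  lra.
- have [H _] := step _ _ (Heta _ _ (aS i)); move: H.
  rewrite distrC; apply: le_trans; rewrite le_eqVlt; apply/orP; left.
  by apply/eqP; congr (`|_|); ring.
- have [H _] := step _ _ (Heta _ _ (gS j)); move: H.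
  apply: le_trans; rewrite le_eqVlt; apply/orP; left.
  by apply/eqP; congr (`|_|); ring.
- have [_ H] := step _ _ (Heta _ _ (aS i)); move: H.
  rewrite distrC; apply: le_trans; rewrite le_eqVlt; apply/orP; left.
  by apply/eqP; congr (`|_|); ring.
- have [_ H] := step _ _ (Heta _ _ (gS j)); move: H.
  apply: le_trans; rewrite le_eqVlt; apply/orP; left.
  by apply/eqP; congr (`|_|); ring.
have close : `|h (a i) - h (g j)| < d.
  apply: (@le_lt_trans _ _ (2 * (d / 3))); last by lra.
  by apply: (le_of_dot_cross lu u0); rewrite ?dotB ?crossB.
(* Uniform injectivity makes [a i] and [g j] themselves close, but their heights differ by more than
   1. *)
have := Hd _ _ close; rewrite -(ltr_pM2l (_ : 0 < 2 * `|u|)) ?mulr_gt0//.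
rewrite divff ?gt_eqF ?mulr_gt0// => close'.
have := le_lt_trans (cross_le u (a i - g j)) close'.
rewrite crossB gcross ltr_norml => /andP[_ ?].
have := aC i 0%N; rewrite /= ler_norml => /andP[? _].
have : 0 <= j%:R * tau * D.
  exact: mulr_ge0 (mulr_ge0 (ler0n _ _) (ltW tau0)) (le_trans ler01 D1).
lra.
Qed.

(** Displacements are invariant under lattice translations, so [y] can be moved below the barrier,
    at bounded height difference from [z], where [barrier] applies. *)
Lemma cross_disp_bounded z u : lattice u -> u != 0 -> linked z (z + u) ->
  exists C, forall n y,
    cross u ((iter n F y - y) - (iter n F z - z)) <= C.
Proof.
move=> lu u0 H; have [C0 HC0] := barrier lu u0 H.
have D1 := lattice_sqr_ge1 lu u0; set D := u.1 ^+ 2 + u.2 ^+ 2 in D1.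
pose k := Num.bound (`|C0| + 2 * `|u|).
have Hk : `|C0| + 2 * `|u| < k%:R.
  by apply: archi_boundP; rewrite addr_ge0// mulr_ge0.
exists (C0 + k%:R * D + 2 * `|u|) => n y.
have [w lw Hw] := lattice_reduce_norm (y - z).
have crossyz : `|cross u (y - z - w)| <= 2 * `|u|.
  by apply: le_trans (cross_le _ _) _; rewrite -[leRHS]mulr1 ler_wpM2l ?mulr_ge0.
(* [w] brings [y] near [z], and [k] copies of the quarter turn of [u] then push it below the
   barrier. *)
pose v : R * R := w + ((- u.2, u.1) : R * R) *+ k.
have lv : lattice v.
  apply: latticeD => //; apply: latticeMn; have /andP[l1 l2] := lu.
  by rewrite /lattice /= rpredN l2.
have vE : v = w + k%:R *: ((- u.2, u.1) : R * R) by rewrite scaler_nat.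
have [_ Fv] := Fn_eq n.
have Dk : k%:R <= k%:R * D by rewrite ler_peMr.
have := HC0 n (y - v); rewrite (Fv y (- v)); last exact: latticeN.
have -> : cross u (iter n F y - v) = cross u (iter n F y) - cross u w - k%:R * D.
  by rewrite vE /cross /D !pair_linE /=; ring.
have -> : cross u (y - v) = cross u y - cross u w - k%:R * D.
  by rewrite vE /cross /D !pair_linE /=; ring.
have yzE : cross u (y - z - w) = cross u y - cross u z - cross u w.
  by rewrite /cross !pair_linE /=; ring.
rewrite yzE ler_norml in crossyz; case/andP: crossyz => l1 l2.
have := ler_norm C0 => C0n Hlt.
have {}Hlt := Hlt _.
have E : cross u (iter n F y - y - (iter n F z - z)) =
  cross u (iter n F y) - cross u y - (cross u (iter n F z) - cross u z).
  by rewrite /cross !pair_linE /=; ring.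
rewrite E.
have : cross u y - cross u w - k%:R * D < cross u z - C0 by lra.
by move=> /Hlt; lra.
Qed.

Lemma cross_disp_norm_bounded z u : lattice u -> u != 0 -> linked z (z + u) ->
  exists C, forall n y,
    `|cross u ((iter n F y - y) - (iter n F z - z))| <= C.
Proof.
move=> lu u0 H; have [C1 H1] := cross_disp_bounded lu u0 H.
(* The period [- u] reverses the sign of [cross] and yields the lower bound. *)
have [||C2 H2] := @cross_disp_bounded z (- u) (latticeN lu).
- by rewrite oppr_eq0.
- have := linkedD (latticeN lu) H; rewrite addrK; exact: linked_sym.
exists (C1 + C2) => n y; have := H1 n y; have := H2 n y.
have := H1 0%N z; have := H2 0%N z.
rewrite /= !subrr; set w := _ - _.
have -> : cross (- u) w = - cross u w by rewrite /cross !pair_linE /=; ring.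
by rewrite /cross /= !mulr0 subrr => ? ? ? ?; rewrite ler_norml; apply/andP; split; lra.
Qed.

Lemma disp_bounded z u u' : lattice u -> u != 0 -> linked z (z + u) ->
  lattice u' -> u' != 0 -> linked z (z + u') -> cross u u' != 0 ->
  exists C, forall n x y,
    `|(iter n F x - x) - (iter n F y - y)| <= C.
Proof.
move=> lu u0 H lu' u0' H' uu'.
have [C1 H1] := cross_disp_norm_bounded lu u0 H.
have [C2 H2] := cross_disp_norm_bounded lu' u0' H'.
have E0 : 0 < `|cross u u'| by rewrite normr_gt0.
(* Cramer's rule recovers a vector from its cross products with [u] and [u']. *)
pose C := (`|u'| * C1 + `|u| * C2) / `|cross u u'|.
have HC n x : `|(iter n F x - x) - (iter n F z - z)| <= C.
  have := H1 n x; have := H2 n x; set w := _ - _ => h2 h1.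
  have b (s t r : R) : `|s| <= `|u'| -> `|t| <= `|u| ->
      cross u u' * r = s * cross u w - t * cross u' w -> `|r| <= C.
    move=> su tu' E; rewrite /C ler_pdivlMr// mulrC -normrM E.
    apply: le_trans (ler_normB _ _) _; rewrite !normrM.
    by apply: lerD; exact: ler_pM.
  rewrite norm_pair_le; apply/andP; split.
    apply: (b u'.1 u.1); [exact: norm_fst_le|exact: norm_fst_le|].
    by rewrite /cross; ring.
  apply: (b u'.2 u.2); [exact: norm_snd_le|exact: norm_snd_le|].
  by rewrite /cross; ring.
exists (C + C) => n x y.
have := pair_dist_triangle (iter n F x - x) (iter n F z - z) (iter n F y - y).
have := HC n x; have := HC n y; rewrite [`|iter n F y - y - _|]pair_distC; lra.
Qed.

End Links.

(** * Passing between the torus and the plane *)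

Section TorusSide.
Variable R : realType.
Implicit Types (x y z v : R * R).

Lemma norm_le_euclidean x y : `|x - y| <= euclidean_dist x y.
Proof.
rewrite norm_pair_le /euclidean_dist -!sqrtr_sqr.
by apply/andP; split; apply: ler_wsqrtr; rewrite ?lerDl ?lerDr sqr_ge0.
Qed.

Lemma euclidean_le_norm x y : euclidean_dist x y <= 2 * `|x - y|.
Proof.
have m0 := normr_ge0 (x - y).
rewrite -[leRHS]ger0_norm ?mulr_ge0// -sqrtr_sqr; apply: ler_wsqrtr.
have sq (s : R) : `|s| <= `|x - y| -> s ^+ 2 <= `|x - y| ^+ 2.
  by move=> H; rewrite -[s ^+ 2]real_normK ?num_real// lerXn2r ?nnegrE.
have := sq _ (norm_fst_le (x - y)); have := sq _ (norm_snd_le (x - y)).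
by rewrite /= exprMn; have := sqr_ge0 `|x - y|; lra.
Qed.

Lemma torus_dist_le x y :
  torus_dist (torus_pi x) (torus_pi y) <= euclidean_dist x y.
Proof.
apply: ge_inf; last by exists x, y.
by exists 0 => _ [x' [y' [_ _ ->]]]; exact: sqrtr_ge0.
Qed.

Lemma torus_dist_lt x y (e : R) :
  torus_dist (torus_pi x) (torus_pi y) < e ->
  exists2 v, lattice v & `|x - y - v| < e.
Proof.
move=> H; pose d := torus_dist (torus_pi x) (torus_pi y).
have de : 0 < e - d by rewrite subr_gt0.
have [|_ [x' [y' [xx yy ->]]]] := inf_adherent de (E := [set r | exists x' y',
    [/\ torus_pi x' = torus_pi x, torus_pi y' = torus_pi y
      & r = euclidean_dist x' y']]).
  split; first by exists (euclidean_dist x y), x, y.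
  by exists 0 => _ [a [b [_ _ ->]]]; exact: sqrtr_ge0.
rewrite -/(torus_dist (torus_pi x) (torus_pi y)) -/d addrC subrK => lte.
exists ((x - x') - (y - y')).
  by apply: latticeB; apply/torus_piP.
apply: le_lt_trans lte; apply: le_trans (norm_le_euclidean _ _).
by have -> : x - y - (x - x' - (y - y')) = x' - y' by ring.
Qed.

Lemma torus_pi_open z (r : R) :
  open [set p | exists2 x, `|x - z| < r & torus_pi x = p].
Proof.
(* Openness in the quotient is openness of the preimage, here the union of the lattice translates of
   the ball. *)
suff : open [set x | exists2 b, `|b - z| < r & torus_pi b = torus_pi x] by [].
rewrite openE => x [b bz /torus_piP bx].
have d0 : 0 < r - `|b - z| by rewrite subr_gt0.
rewrite /interior; apply/nbhs_ballP; exists (r - `|b - z|) => //= y.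
rewrite -ball_normE /= => xy.
exists (y + (b - x)); last exact: torus_piD.
have -> : y + (b - x) - z = (b - z) - (x - y) by ring.
by apply: le_lt_trans (pair_normB _ _) _; rewrite addrC -ltrBrDr.
Qed.

(** If a lifted distance exceeded 1/2, some point of the segment would have lifted distance exactly
    1/2. Torus distance below 1/4 then yields a lattice vector of norm below 3/4, hence zero, and
    the lifted distance would be below 1/4. *)
Lemma stable_lift (f : torus R -> torus R) (F : R * R -> R * R) z (r : R) :
  is_lift f F ->
  (forall x n, `|x - z| < r ->
    torus_dist (iter n f (torus_pi z)) (iter n f (torus_pi x)) < 4^-1) ->
  forall x n, `|x - z| < r -> `|iter n F x - iter n F z| <= 2^-1.
Proof.
move=> Fl H x n xz; rewrite leNgt; apply/negP => far.
have [Gc Gl] := lift_iter Fl n; set G := iter n F in Gc Gl far.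
have gc : continuous (fun w : R * R => `|G w - G z|).
  by move=> w; apply: cvg_norm; apply: cvgB; [exact: Gc|exact: cvg_cst].
have [||t /andP[t0 t1] Ht] := @ivt_segment R _ z (x - z) 2^-1 gc.
- by rewrite subrr normr0 invr_ge0.
- by rewrite [z + _]addrC subrK; exact: ltW.
set w := z + t *: (x - z) in Ht.
have wz : `|w - z| < r.
  rewrite /w addrAC subrr add0r pair_normZ ger0_norm//.
  by apply: le_lt_trans xz; rewrite ler_piMl.
have := H w n wz.
have piG q : iter n f (torus_pi q) = torus_pi (G q).
  by rewrite -[RHS]/((@torus_pi R \o G) q) Gl.
rewrite !piG => /torus_dist_lt[v lv Hv].
have v0 : v = 0.
  apply: lattice_norm_lt1 => //.
  have := pair_normB (G z - G w) (G z - G w - v).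
  have -> : G z - G w - (G z - G w - v) = v by ring.
  by rewrite [`|G z - G w|]pair_distC; lra.
by move: Hv; rewrite v0 subr0 pair_distC; lra.
Qed.

Lemma lift_injective (f : torus R -> torus R) (F : R * R -> R * R) :
  is_lift f F -> equivariant F -> injective f -> injective F.
Proof.
move=> [_ Fl] [_ Fv] finj x y Fxy.
have /torus_piP lxy : torus_pi x = torus_pi y.
  apply: finj; rewrite -[LHS]/((f \o @torus_pi R) x) -[RHS]/((f \o @torus_pi R) y).
  by rewrite -Fl /= Fxy.
have := Fv y _ lxy; rewrite [y + _]addrC subrK Fxy => /eqP.
by rewrite addrC -subr_eq subrr eq_sym subr_eq0 => /eqP.
Qed.

End TorusSide.

(** * Recurrence, irrationality and the conclusion *)

(** Long returns are obtained by induction: the points returning at time [m] contain an open set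
    [W], and a return of [W] to itself at a further positive time gives a longer return to [U]. *)
Lemma nonwandering_returns (X : topologicalType) (f : X -> X) (U : set X) :
  continuous f -> nonwandering f -> open U -> U !=set0 ->
  forall N, exists n, (N <= n)%N /\ exists2 p, U p & U (iter n f p).
Proof.
move=> fc fnw Uo U0 N.
have fic n : continuous (iter n f).
  elim: n => [|n IH] x; first exact: cvg_id.
  by apply: (@continuous_comp _ _ _ (iter n f) f); [exact: IH|exact: fc].
suff [m [Nm [W [Wo [p Wp] WU]]]] : exists m, (N <= m)%N /\ exists W : set X,
    [/\ open W, W !=set0 & forall p, W p -> U p /\ U (iter m f p)].
  by exists m; split=> //; have [Up Ump] := WU p Wp; exists p.
elim: N => [|N [m [Nm [W [Wo W0 WU]]]]].
  by exists 0%N; split=> //; exists U; split.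
have [n n0 [p [Wp [q Wq qE]]]] : exists2 n, (0 < n)%N &
    W `&` (iter n f @` W) !=set0.
  apply: contrapT => H; apply: fnw; exists W; split=> // n n0.
  by apply/seteqP; split=> // x Wx; apply: H; exists n => //; exists x.
exists (m + n)%N; split.
  by rewrite -addn1; exact: leq_add.
exists (W `&` (iter n f @^-1` W)); split.
- by apply: openI => //; apply: open_comp => // x _; exact: fic.
- by exists q; split=> //=; rewrite qE.
- move=> s [Ws Wnp]; rewrite iterD.
  by split; [apply: (WU s Ws).1|apply: (WU _ Wnp).2].
Qed.

Lemma totally_irrational_int (R : realType) (rho : R * R) (a b c : R) :
  totally_irrational rho ->
  a \is a Num.int -> b \is a Num.int -> c \is a Num.int ->
  a + b * rho.1 + c * rho.2 = 0 -> b = 0 /\ c = 0.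
Proof.
move=> irr /intrP[i ->] /intrP[j ->] /intrP[k ->] E.
have [|_ j0 k0] := irr i%:~R j%:~R k%:~R; first by rewrite !ratr_int.
by move: j0 k0 => /eqP + /eqP; rewrite !intr_eq0 => /eqP -> /eqP ->.
Qed.

Theorem corollary4p2 (R : realType) (f : torus R -> torus R)
    (F : R * R -> R * R) (rho : R * R)
    (f_homeo : Homeo0 f)
    (f_nonwandering : nonwandering f)
    (f_pseudo_rotation : irrational_pseudo_rotation f F rho)
    (f_unbounded : ~ bounded_mean_motion F rho) :
  sensitive_dependence (@torus_dist R) f.
Proof.
have [Fl Frho irr] := f_pseudo_rotation.
have [[fc [g [_ fg _]]] _] := f_homeo.
have Feq := lift_equivariant Fl Frho.
have Finj := lift_injective Fl Feq (can_inj fg).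
apply: contrapT => insensitive; apply: f_unbounded.
(* Failure of sensitivity at the constant 1/4 gives a stable ball; its radius is halved because the
   Euclidean distance is at most twice the sup norm. *)
have [z [r r0 stable]] : exists z : R * R, exists2 r : R, 0 < r &
    forall x n, `|x - z| < r -> `|iter n F x - iter n F z| <= 2^-1.
  apply: contrapT => H; apply: insensitive; exists 4^-1; first by rewrite invr_gt0.
  move=> p d d0; apply: contrapT => Hp; apply: H.
  have [z zp] := torus_pi_surj p; exists z; exists (d / 2); first by rewrite divr_gt0.
  apply: stable_lift Fl _ => x n xz; rewrite ltNge; apply/negP => Hn.
  apply: Hp; exists (torus_pi x); split; last by exists n; rewrite -zp.
  rewrite -zp; apply: le_lt_trans (torus_dist_le _ _) _.
  apply: le_lt_trans (euclidean_le_norm _ _) _.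
  by rewrite pair_distC mulrC -ltr_pdivlMr.
have link x : `|x - z| < r -> linked F z x by move=> xz; exact: linked_ball stable xz.
have returns (e : R) : 0 < e -> exists n v, [/\ (0 < n)%N, lattice v,
    linked F (iter n F z) (z + v) & `|v - n%:R *: rho| <= n%:R * e].
  move=> e0; have e2 : 0 < e / 2 by rewrite divr_gt0.
  have [N HN] := mean_cvg_uniform Fl Frho e2.
  (* [n * e > 4 * r] makes the error from the endpoints in the ball, at most [2 * r], less than half
     of [n * e]. *)
  pose N' := maxn N (Num.bound (4 * r / e)).+1.
  have [|n [Nn [p [x xz <-] [y yz]]]] := nonwandering_returns fc f_nonwandering
    (@torus_pi_open R z r) _ N'.
    by exists (torus_pi z); exists z => //; rewrite subrr normr0.
  have [_ Gl] := lift_iter Fl n.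
  rewrite -[iter n f _]/((iter n f \o @torus_pi R) x) -Gl /= => /esym/torus_piP lv.
  have n0 : (0 < n)%N.
    by apply: leq_trans Nn; rewrite leq_max orbT.
  have nR : 0 < n%:R :> R by rewrite ltr0n.
  exists n, (iter n F x - y); split=> //.
    have /(linkedD Feq lv) : linked F z y by exact: link.
    rewrite [y + _]addrC subrK => zx.
    apply: linked_trans (linked_sym zx).
    exact: linked_iter Feq n _ _ (link x xz).
  have Nn' : (N <= n)%N by apply: leq_trans Nn; exact: leq_maxl.
  have D3 : `|iter n F x - x - n%:R *: rho| <= n%:R * (e / 2).
    have -> : iter n F x - x - n%:R *: rho =
        n%:R *: (n%:R^-1 *: (iter n F x - x) - rho).
      by rewrite scalerBr scalerA divff ?scale1r ?gt_eqF.
    by rewrite pair_normZ ger0_norm// ler_pM2l//; apply/ltW/HN.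
  have rn : 4 * r < n%:R * e.
    rewrite -ltr_pdivrMr//; apply: lt_le_trans (archi_boundP _) _.
      by rewrite divr_ge0 ?(ltW e0)// mulr_ge0 ?(ltW r0).
    by rewrite ler_nat; apply: leq_trans Nn; rewrite leq_max leqnSn orbT.
  have -> : iter n F x - y - n%:R *: rho =
      (iter n F x - x - n%:R *: rho) + ((x - z) - (y - z)) by ring.
  have := pair_normD (iter n F x - x - n%:R *: rho) ((x - z) - (y - z)).
  by have := pair_normB (x - z) (y - z); lra.
have [n1 [v1 [n10 lv1 H1 _]]] := returns 1 ltr01.
have nR : 0 < n1%:R :> R by rewrite ltr0n.
(* Combining a return [(n, v)] with [(n1, v1)] gives the period [v *+ n1 - v1 *+ n]; it is
   approximately [n%:R *: alpha], since [v] is approximately [n%:R *: rho]. *)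
pose alpha := n1%:R *: rho - v1.
have period (e : R) : 0 < e -> exists n u, [/\ (0 < n)%N, lattice u,
    linked F z (z + u) & `|u - n%:R *: alpha| <= n%:R * e].
  move=> e0; have [n [v [n0 lv Hv vn]]] := returns (e / n1%:R) (divr_gt0 e0 nR).
  exists n, (v *+ n1 - v1 *+ n); split=> //.
  - by apply: latticeB; exact: latticeMn.
  - exact: linked_two_returns.
  have -> : v *+ n1 - v1 *+ n - n%:R *: alpha = n1%:R *: (v - n%:R *: rho).
    by rewrite /alpha !scalerBr !scaler_nat opprB addrA subrK mulrnAC.
  rewrite pair_normZ (ger0_norm (ltW nR)).
  apply: le_trans (ler_wpM2l (ltW nR) vn) _.
  by rewrite mulrCA (mulrC n1%:R) divfK ?gt_eqF.
have nint (n : nat) : n%:R \is a @Num.int R by rewrite pmulrn intr_int.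
have [l11 l12] := andP lv1.
have alpha1 : alpha.1 != 0.
  apply/eqP; rewrite /alpha !pair_linE => E.
  have [||||n10' _] := @totally_irrational_int R rho (- v1.1) n1%:R 0 irr.
  - by rewrite rpredN.
  - exact: nint.
  - exact: rpred0.
  - by rewrite mul0r addr0 addrC.
  by move: nR; rewrite n10' ltxx.
(* With this tolerance [u = 0] would bound the norm of [alpha] by half that of [alpha.1]. *)
have [|n [u [n0 lu Hu un]]] := period (`|alpha.1| / 2).
  by rewrite divr_gt0// normr_gt0.
have u0 : u != 0.
  apply/eqP => uz; move: un; rewrite uz sub0r normrN pair_normZ ger0_norm//.
  rewrite ler_pM2l ?ltr0n//; have := norm_fst_le alpha.
  have : 0 < `|alpha.1| by rewrite normr_gt0.
  lra.
(* This cross product is an integer combination of 1, [rho.1] and [rho.2], whose vanishing would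
   force [u = 0]. *)
have beta0 : cross u alpha != 0.
  apply/eqP; rewrite /cross /alpha !pair_linE => E.
  have [lu1 lu2] := andP lu.
  have [||||b1 b2] := @totally_irrational_int R rho (u.2 * v1.1 - u.1 * v1.2)
      (- u.2 * n1%:R) (u.1 * n1%:R) irr.
  - by rewrite rpredB// rpredM.
  - by rewrite rpredM ?rpredN.
  - by rewrite rpredM.
  - by rewrite -E; ring.
  case/eqP: u0; rewrite [u]surjective_pairing.
  move: b1 b2 => /eqP + /eqP.
  by rewrite !mulf_eq0 oppr_eq0 !(gt_eqF nR) !orbF => /eqP -> /eqP ->.
have U0 : 0 < `|u| by rewrite normr_gt0.
(* With this tolerance, if [u] and [u'] were parallel, the absolute value of [n' * cross u alpha]
   would be at most half of itself. *)
have [|n' [u' [n0' lu' Hu' un']]] := period (`|cross u alpha| / (4 * `|u|)).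
  by rewrite divr_gt0 ?mulr_gt0// normr_gt0.
have uu' : cross u u' != 0.
  apply/eqP => E; have := cross_le u (u' - n'%:R *: alpha).
  have -> : cross u (u' - n'%:R *: alpha) = - (n'%:R * cross u alpha).
    by rewrite -[RHS]add0r -E /cross !pair_linE; ring.
  rewrite normrN normrM ger0_norm// leNgt => /negP; apply.
  have nR' : 0 < n'%:R :> R by rewrite ltr0n.
  have b0 : 0 < `|cross u alpha| by rewrite normr_gt0.
  apply: le_lt_trans (ler_wpM2l _ un') _; first by rewrite mulr_ge0.
  have -> : 2 * `|u| * (n'%:R * (`|cross u alpha| / (4 * `|u|))) =
      n'%:R * `|cross u alpha| / 2 by field; rewrite gt_eqF.
  by rewrite ltr_pdivrMr// ltr_pMr ?mulr_gt0//; lra.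
have u0' : u' != 0.
  by apply/eqP => uz; move: uu'; rewrite uz /cross /= !mulr0 subrr eqxx.
have [C HC] := disp_bounded Feq Finj lu u0 Hu lu' u0' Hu' uu'.
exists (2 * C) => m x; apply: le_trans (euclidean_le_norm _ _) _.
by rewrite subr0 ler_pM2l//; exact: (uniform_disp_bounded Fl Frho HC).
Qed.
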